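(* Let $A$ be a commutative ring with identity, let $d\geq 1$ be an integer, and let $R=A[\mathbb{R}_{\geq 0}^d]$ be the semigroup ring of the additive semigroup $\mathbb{R}_{\geq 0}^d$ over $A$. A monomial ideal $I$ of $R$ is m-irreducible if and only if it is generated by a set of pure powers of the variables $X_1,\ldots,X_d$.
   Context: $\mathbb{R}_{\geq 0}=\{r\in\mathbb{R}\mid r\geq 0\}$. The ring $R=A[\mathbb{R}_{\geq 0}^d]$ is thought of as the set of all polynomials in $X_1,\ldots,X_d$ with coefficients in $A$ and non-negative real exponents, i.e. finite $A$-linear combinations of monomials. A monomial is an element $\underline{X}^{\underline{r}}=X_1^{r_1}\cdots X_d^{r_d}$ with $\underline{r}=(r_1,\ldots,r_d)\in\mathbb{R}_{\geq 0}^d$, and $\underline{X}^{\underline{q}}\,\underline{X}^{\underline{r}}=\underline{X}^{\underline{q}+\underline{r}}$. A monomial ideal of $R$ is an ideal generated by a (possibly empty, possibly infinite) set of monomials. A pure power is a monomial of the form $X_i^r$ with $1\leq i\leq d$ and $r\in\mathbb{R}_{\geq 0}$; a generating set of pure powers may be empty (giving the zero ideal) or infinite. A monomial ideal $I$ of $R$ is m-irreducible if for all monomial ideals $J,K$ of $R$ with $I=J\cap K$, either $I=J$ or $I=K$. *)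

(* Defs.v *)
From HB Require Import structures.
From mathcomp Require Import all_boot all_order all_algebra.
From mathcomp Require Import finmap monalg.
From mathcomp Require Import classical_sets reals.

Set Implicit Arguments.
Unset Strict Implicit.
Unset Printing Implicit Defensive.

Import Order.TTheory GRing.Theory Num.Theory.

Local Open Scope ring_scope.

(* The ring structure that monalg puts on {malg A[M]} requires 1 != 0 in A and
   a multiplicatively written monoid of exponents. The structure below uses the
   same carrier and the same convolution product, for an additive commutative
   monoid M and a coefficient ring A that is allowed to be trivial. *)
Definition semigroup_ring (A : comPzRingType) (M : nmodType) : Type :=
  {malg A[M]}.

Section SemigroupRing.
Local Open Scope fset_scope.
Variables (A : comPzRingType) (M : nmodType).

HB.instance Definition _ := GRing.Zmodule.on (semigroup_ring A M).

Implicit Types (f g h : semigroup_ring A M) (k : M).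

Definition sgr_one : semigroup_ring A M := << 1 *g 0%R >>.

Definition sgr_mul f g : semigroup_ring A M :=
  \sum_(k1 <- msupp f) \sum_(k2 <- msupp g) << f@_k1 * g@_k2 *g (k1 + k2)%R >>.

Lemma sgr_mulw (d1 d2 : {fset M}) f g :
  msupp f `<=` d1 -> msupp g `<=` d2 ->
  sgr_mul f g =
    \sum_(k1 <- d1) \sum_(k2 <- d2) << f@_k1 * g@_k2 *g (k1 + k2)%R >>.
Proof.
move=> le_d1 le_d2; rewrite /sgr_mul (big_fset_incl _ le_d1) /=.
  apply/eq_bigr=> k1 _; apply/big_fset_incl => // k _ /mcoeff_outdom ->.
  by rewrite mulr0 monalgU0.
move=> k _ /mcoeff_outdom fk.
by rewrite big1 => // k' _; rewrite fk mul0r monalgU0.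
Qed.

Lemma sgr_mulC : commutative sgr_mul.
Proof.
move=> f g; rewrite /sgr_mul exchange_big /=; apply/eq_bigr=> k1 _.
by apply/eq_bigr=> k2 _; rewrite mulrC addrC.
Qed.

Lemma sgr_mulDl : left_distributive sgr_mul +%R.
Proof.
move=> f g h.
rewrite [in RHS](sgr_mulw (fsubsetUl _ (msupp g)) (fsubset_refl (msupp h))).
rewrite [in RHS](sgr_mulw (fsubsetUr (msupp f) _) (fsubset_refl (msupp h))).
rewrite (sgr_mulw (msuppD_le f g) (fsubset_refl (msupp h))).
rewrite -big_split /=; apply/eq_bigr=> k1 _.
rewrite -big_split /=; apply/eq_bigr=> k2 _.
by rewrite mcoeffD mulrDl monalgUD.
Qed.

Lemma sgr_mulDr : right_distributive sgr_mul +%R.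
Proof. by move=> f g h; rewrite ![sgr_mul f _]sgr_mulC sgr_mulDl. Qed.

Lemma sgr_mul0l : left_zero (0 : semigroup_ring A M) sgr_mul.
Proof. by move=> f; rewrite /sgr_mul msupp0 big_seq_fset0. Qed.

Lemma sgr_mul0r : right_zero (0 : semigroup_ring A M) sgr_mul.
Proof. by move=> f; rewrite sgr_mulC sgr_mul0l. Qed.

Lemma sgr_mulUU (a b : A) k1 k2 :
  sgr_mul << a *g k1 >> << b *g k2 >> = << a * b *g (k1 + k2)%R >>.
Proof. by rewrite (sgr_mulw msuppU_le msuppU_le) !big_seq_fset1 !mcoeffUU. Qed.

Lemma sgr_mul_suml (I : Type) (r : seq I) (F : I -> semigroup_ring A M) g :
  sgr_mul (\sum_(i <- r) F i) g = \sum_(i <- r) sgr_mul (F i) g.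
Proof.
exact: (big_morph (sgr_mul^~ g) (fun _ _ => sgr_mulDl _ _ _) (sgr_mul0l _)).
Qed.

Lemma sgr_mul_sumr (I : Type) (r : seq I) (F : I -> semigroup_ring A M) f :
  sgr_mul f (\sum_(i <- r) F i) = \sum_(i <- r) sgr_mul f (F i).
Proof.
exact: (big_morph (sgr_mul f) (fun _ _ => sgr_mulDr _ _ _) (sgr_mul0r _)).
Qed.

Lemma sgr_mulA : associative sgr_mul.
Proof.
move=> f g h.
rewrite (monalgE f) [LHS]sgr_mul_suml.
rewrite [X in _ = sgr_mul X _]sgr_mul_suml [RHS]sgr_mul_suml.
apply/eq_bigr=> k1 _.
rewrite (monalgE g) [X in sgr_mul _ X = _]sgr_mul_suml [LHS]sgr_mul_sumr.
rewrite [X in _ = sgr_mul X _]sgr_mul_sumr [RHS]sgr_mul_suml.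
apply/eq_bigr=> k2 _.
rewrite (monalgE h) [X in sgr_mul _ X = _]sgr_mul_sumr [LHS]sgr_mul_sumr.
rewrite [RHS]sgr_mul_sumr; apply/eq_bigr=> k3 _.
by rewrite !sgr_mulUU mulrA addrA.
Qed.

Lemma sgr_mul1 : left_id sgr_one sgr_mul.
Proof.
move=> f; rewrite {1}(monalgE f) sgr_mul_sumr [RHS]monalgE.
by apply/eq_bigr=> k _; rewrite sgr_mulUU mul1r add0r.
Qed.

HB.instance Definition _ := GRing.Zmodule_isComPzRing.Build (semigroup_ring A M)
  sgr_mulA sgr_mulC sgr_mul1 sgr_mulDl.

End SemigroupRing.

Section NonnegativeReals.
Variable R : realType.

Record nnreal := NNReal { nnreal_val :> R; _ : 0 <= nnreal_val }.

HB.instance Definition _ := [isSub for nnreal_val].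
HB.instance Definition _ := [Choice of nnreal by <:].
Fact nnreal_addr_closed : addr_closed [pred x : R | 0 <= x].
Proof. by split=> [|x y]; rewrite !inE ?lexx //; apply: addr_ge0. Qed.

HB.instance Definition _ :=
  GRing.SubChoice_isSubNmodule.Build R _ nnreal nnreal_addr_closed.

End NonnegativeReals.

(* A[RR_{>=0}^d]; addition of exponent vectors is pointwise. *)
Definition real_exp_ring (R : realType) (A : comPzRingType) (d : nat) :
  comPzRingType := semigroup_ring A {ffun 'I_d -> nnreal R}.

Section Ideals.
Local Open Scope classical_set_scope.
Variable S : comPzRingType.

(* ring_quotient's idealr only covers proper ideals given by boolean
   predicates. *)
Definition is_ideal (I : set S) : Prop :=
  [/\ I 0, forall f g, I f -> I g -> I (f + g) &
      forall f g, I g -> I (f * g)].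

Definition ideal_generated (G : set S) : set S := smallest is_ideal G.

End Ideals.

Section MonomialIdeals.
Local Open Scope classical_set_scope.
Variables (R : realType) (A : comPzRingType) (d : nat).

Definition monomial (r : {ffun 'I_d -> nnreal R}) : real_exp_ring R A d :=
  << 1 *g r >>.

Definition pure_power (i : 'I_d) (r : nnreal R) : real_exp_ring R A d :=
  monomial [ffun j => if j == i then r else 0].

Definition monomial_ideal (I : set (real_exp_ring R A d)) : Prop :=
  exists2 G, G `<=` range monomial & I = ideal_generated G.

Definition m_irreducible (I : set (real_exp_ring R A d)) : Prop :=
  forall J K, monomial_ideal J -> monomial_ideal K ->
    I = J `&` K -> I = J \/ I = K.

Definition generated_by_pure_powers (I : set (real_exp_ring R A d)) : Prop :=
  exists2 G, G `<=` [set f | exists i r, f = pure_power i r] &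
    I = ideal_generated G.

Lemma monomialM q r : monomial q * monomial r = monomial (q + r).
Proof. by rewrite [LHS]sgr_mulUU mulr1. Qed.

End MonomialIdeals.

(* Main.v *)
Require Import Defs.
From mathcomp Require Import all_boot all_algebra classical_sets reals.
From mathcomp Require Import order finmap monalg boolp.

(** A monomial ideal is determined by the set [U] of exponents of its monomials:
    it consists of the [f] whose support lies in [U], and [U] is an up-set for
    the divisibility order, which on exponents is the coordinatewise order.
    Intersection of ideals becomes intersection of up-sets, and the monomials
    divisible by both [X^a] and [X^b] are those divisible by [X^(a \/ b)], where
    [a \/ b] is the coordinatewise maximum.  Both sides of the equivalence turn
    out to say that [U] is join-prime: [a \/ b] in [U] forces [a] or [b] in [U].

    - Irreducibility ([m_irreducible_join_primeP]).  If [U] is not join-prime because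
      of [a] and [b], adding to [U] the multiples of [a], respectively of [b],
      gives two strictly larger up-sets meeting in [U].  Conversely, if
      [U = V `&` W] with [a] in [V] and [b] in [W] both outside [U], then
      [a \/ b] is in [V `&` W = U].

    - Pure powers ([join_prime_axis_generatedP]).  The real order being total,
      [r <= max (a i) (b i)] implies [r <= a i] or [r <= b i], so an up-set
      generated by points on the coordinate axes is join-prime.  Conversely every
      exponent is the finite join of its projections to the axes, so a join-prime
      up-set contains, below each of its elements, one of these projections.

    Over the zero ring the support no longer remembers [U], but there all ideals
    coincide. *)

Set Implicit Arguments.
Unset Strict Implicit.
Unset Printing Implicit Defensive.

Import Order.TTheory GRing.Theory Num.Theory.

(** * Up-sets of exponents *)

Section Exponents.
Local Open Scope ring_scope.
Local Open Scope classical_set_scope.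
Variables (R : realType) (d : nat).
Notation expo := {ffun 'I_d -> nnreal R}.
Implicit Types (a b k p s : expo) (S U : set expo).

Definition upset U := forall p k, U k -> U (p + k).

Definition up_closure S : set expo :=
  [set k | exists2 s, S s & exists p, k = p + s].

Definition join a b : expo :=
  [ffun i => if (a i : R) <= (b i : R) then b i else a i].

Definition join_prime U := forall a b, U (join a b) -> U a \/ U b.

Definition axis (i : 'I_d) (r : nnreal R) : expo :=
  [ffun j => if j == i then r else 0].

Lemma up_closure_upset S : upset (up_closure S).
Proof. by move=> p k [s Ss [q ->]]; exists s => //; exists (p + q); rewrite addrA. Qed.

Lemma sub_up_closure S : S `<=` up_closure S.
Proof. by move=> s Ss; exists s => //; exists 0; rewrite add0r. Qed.

Lemma upset_up_closure U : upset U -> up_closure U = U.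
Proof.
move=> upU; apply/seteqP; split; last exact: sub_up_closure.
by move=> k [s Us [p ->]]; apply: upU.
Qed.

(** Divisibility of monomials is the coordinatewise order, because the
    difference of two comparable exponents is again non-negative. *)
Lemma expo_divP s k :
  (exists p, k = p + s) <-> (forall i, (s i : R) <= (k i : R)).
Proof.
split=> [[p ->] i|le_sk].
  by rewrite ffunE /= lerDr; case: (p i).
have sub_ge0 i : 0 <= (k i : R) - (s i : R) by rewrite subr_ge0.
exists [ffun i => NNReal (sub_ge0 i)]; apply/ffunP => i.
by apply: val_inj; rewrite !ffunE /= subrK.
Qed.

Lemma upset_le U s k :
  upset U -> (forall i, (s i : R) <= (k i : R)) -> U s -> U k.
Proof. by move=> upU /expo_divP [p ->]; apply: upU. Qed.

Lemma joinE a b i : (join a b i : R) = Num.max (a i : R) (b i : R).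
Proof. by rewrite ffunE; case: leP. Qed.

Lemma join_le a b k :
  (forall i, (a i : R) <= (k i : R)) -> (forall i, (b i : R) <= (k i : R)) ->
  forall i, (join a b i : R) <= (k i : R).
Proof. by move=> ak bk i; rewrite joinE ge_max ak bk. Qed.

Lemma upset_joinl U a b : upset U -> U a -> U (join a b).
Proof. by move=> upU; apply: upset_le => // i; rewrite joinE le_max lexx. Qed.

Lemma upset_joinr U a b : upset U -> U b -> U (join a b).
Proof. by move=> upU; apply: upset_le => // i; rewrite joinE le_max lexx orbT. Qed.

Lemma axis_le i r k :
  (forall j, (axis i r j : R) <= (k j : R)) <-> (r : R) <= (k i : R).
Proof.
split=> [/(_ i)|le_r j]; first by rewrite ffunE eqxx.
by rewrite ffunE; case: eqP => [-> //|_]; case: (k j).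
Qed.

(** * Join-prime up-sets are generated on the axes *)

Definition axis_generated U :=
  exists2 S, S `<=` [set s | exists i r, s = axis i r] & U = up_closure S.

(** Divisibility by [X_i^r] tests the single coordinate [i], where the maximum
    of two reals is one of them. *)
Lemma axis_generated_join_prime U : axis_generated U -> join_prime U.
Proof.
move=> [S axS ->] a b [s Ss /expo_divP le_s].
have [i [r Es]] := axS _ Ss; rewrite Es in Ss le_s.
move/axis_le: le_s; rewrite joinE le_max => /orP[le_r|le_r].
- by left; exists (axis i r) => //; apply/expo_divP/axis_le.
- by right; exists (axis i r) => //; apply/expo_divP/axis_le.
Qed.

(** The induction peels one coordinate at a time off [k]; the empty join [0] is
    not covered by join-primality, and lies on any axis because [1 <= d]. *)
Lemma join_prime_axis U k :
  (1 <= d)%N -> upset U -> join_prime U -> U k -> exists i, U (axis i (k i)).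
Proof.
move=> d_gt0 upU primeU Uk.
pose restr (t : seq 'I_d) : expo := [ffun i => if i \in t then k i else 0].
have: U (restr (enum 'I_d)).
  suff -> : restr (enum 'I_d) = k by [].
  by apply/ffunP=> i; rewrite ffunE mem_enum.
elim: (enum 'I_d) => [|i t IHt] Ur.
  exists (Ordinal d_gt0); apply: upset_le upU _ Ur => j.
  by rewrite !ffunE in_nil; case: ifP => // _; case: (k _).
have: U (join (axis i (k i)) (restr t)).
  apply: upset_le upU _ Ur => j; rewrite joinE !ffunE in_cons le_max.
  by case: eqP => [->|_]; rewrite lexx ?orbT.
by case/primeU => //; exists i.
Qed.

Lemma join_prime_axis_generatedP U :
  (1 <= d)%N -> upset U -> join_prime U <-> axis_generated U.
Proof.
move=> d_gt0 upU; split; last exact: axis_generated_join_prime.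
move=> primeU; exists [set s | U s /\ exists i r, s = axis i r].
  by move=> s [].
apply/seteqP; split=> [k Uk|k [s [Us _] [p ->]]]; last exact: upU.
have [i Ui] := join_prime_axis d_gt0 upU primeU Uk.
exists (axis i (k i)); first by split=> //; exists i, (k i).
exact/expo_divP/axis_le.
Qed.

End Exponents.

(** * Monomial ideals as up-sets *)

Section MonomialIdealsAsUpsets.
Local Open Scope ring_scope.
Local Open Scope classical_set_scope.
Variables (R : realType) (A : comPzRingType) (d : nat).
Notation expo := {ffun 'I_d -> nnreal R}.
Notation ring := (real_exp_ring R A d).
Notation monomial := (@monomial R A d).
Implicit Types (a b k s : expo) (S U V W : set expo) (f g : ring) (I : set ring).

Definition supported_in U : set ring := [set f | forall k, k \in msupp f -> U k].

Lemma supported_in0 U : supported_in U 0.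
Proof. by move=> k; rewrite msupp0. Qed.

Lemma supported_inD U f g :
  supported_in U f -> supported_in U g -> supported_in U (f + g).
Proof.
move=> Uf Ug k /(fsubsetP (msuppD_le f g)); rewrite in_fsetU.
by case/orP=> [/Uf|/Ug].
Qed.

Lemma supported_inU U (c : A) k : U k -> supported_in U (<< c *g k >> : ring).
Proof. by move=> Uk j /(fsubsetP msuppU_le); rewrite in_fset1 => /eqP ->. Qed.

Lemma supported_in_sum U (J : eqType) (r : seq J) (F : J -> ring) :
  (forall j, j \in r -> supported_in U (F j)) ->
  supported_in U (\sum_(j <- r) F j).
Proof.
move=> UF; rewrite big_seq; apply: big_ind => //; first exact: supported_in0.
exact: supported_inD.
Qed.

Lemma supported_in_ideal U : upset U -> is_ideal (supported_in U).
Proof.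
move=> upU; split; first exact: supported_in0.
  exact: supported_inD.
move=> f g Ug; change (supported_in U (sgr_mul f g)); rewrite /sgr_mul.
apply: supported_in_sum => p _; apply: supported_in_sum => k /Ug Uk.
by apply: supported_inU; apply: upU.
Qed.

(** The support of a product [f * g] consists of sums of exponents of [f] and [g],
    whence one inclusion; conversely, any term of [f] whose exponent lies above
    some [s] in [S] is a multiple of the generator [monomial s]. *)
Lemma ideal_generated_monomials S :
  ideal_generated (monomial @` S) = supported_in (up_closure S).
Proof.
apply/seteqP; split.
  apply: smallest_sub; first exact/supported_in_ideal/up_closure_upset.
  by move=> _ [s Ss <-]; apply: supported_inU; apply: sub_up_closure.
move=> f Uf I [[I0 ID IM] genI].
rewrite (monalgE f) big_seq; apply: big_ind => // k /Uf [s Ss [p ->]].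
have -> : (<< f@_(p + s) *g p + s >> : ring) =
          (<< f@_(p + s) *g p >> : ring) * monomial s.
  by rewrite [RHS]sgr_mulUU mulr1.
by apply/IM/genI; exists s.
Qed.

Lemma monomial_idealP I :
  monomial_ideal I <-> exists2 U, upset U & I = supported_in U.
Proof.
split=> [[G Gmon ->]|[U upU ->]].
  exists (up_closure (monomial @^-1` G)); first exact: up_closure_upset.
  rewrite -ideal_generated_monomials; congr ideal_generated.
  apply/seteqP; split=> [f Gf|_ [k Gk <-] //].
  by have [k _ Ef] := Gmon f Gf; exists k; rewrite //= Ef.
exists (monomial @` U); first by move=> _ [k _ <-]; exists k.
by rewrite ideal_generated_monomials upset_up_closure.
Qed.

Lemma generated_by_pure_powersP I :
  generated_by_pure_powers I <->
  exists2 U, axis_generated U & I = supported_in U.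
Proof.
split=> [[G Gpure ->]|[_ [S axS ->] ->]].
  pose S := [set s | G (monomial s) /\ exists i r, s = axis i r].
  exists (up_closure S); first by exists S => // s [].
  rewrite -ideal_generated_monomials; congr ideal_generated.
  apply/seteqP; split=> [f Gf|_ [k [Gk _] <-] //].
  have [i [r Ef]] := Gpure f Gf; exists (axis i r) => //.
  by split; [rewrite Ef in Gf|exists i, r].
exists (monomial @` S); last by rewrite ideal_generated_monomials.
by move=> _ [s /axS[i [r ->]] <-]; exists i, r.
Qed.

Lemma supported_inI U V :
  supported_in (U `&` V) = supported_in U `&` supported_in V.
Proof.
apply/seteqP; split=> [f UVf|f [Uf Vf] k kf].
  by split=> k /UVf [].
by split; [apply: Uf|apply: Vf].
Qed.

(** When [1 != 0], a monomial has its exponent as support, so [U] is read off as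
    the set of exponents of the monomials in the ideal. *)
Lemma supported_in_inj :
  (1 : A) != 0 -> injective supported_in.
Proof.
move=> A1.
have monU U k : supported_in U (monomial k) <-> U k.
  split=> [|Uk]; last exact: supported_inU.
  by apply; rewrite msuppU (negPf A1) in_fset1.
by move=> U V UV; apply/seteqP; split=> k /monU; rewrite (UV, =^~ UV) => /monU.
Qed.

(** * Irreducibility is join-primality *)

Lemma m_irreducible_join_prime U :
  (1 : A) != 0 -> upset U -> m_irreducible (supported_in U) -> join_prime U.
Proof.
move=> A1 upU irrU a b Uab.
(* The least up-set containing [U] and [c]. *)
pose add c : set expo := U `|` up_closure [set c].
have up_add c : upset (add c).
  by move=> p k [/(upU p)|/(up_closure_upset p)]; [left|right].
have add_in c : U = add c -> U c.
  by move->; right; apply: sub_up_closure.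
have capU : U = add a `&` add b.
  apply/seteqP; split=> [k Uk|k [[//|[_ -> /expo_divP ak]] [//|]]].
    by split; left.
  move=> [_ -> /expo_divP bk]; apply: upset_le upU _ Uab; exact: join_le.
have mon_add c : monomial_ideal (supported_in (add c)).
  by apply/monomial_idealP; exists (add c).
have := irrU _ _ (mon_add a) (mon_add b).
rewrite -supported_inI -capU => /(_ erefl).
by case=> /(supported_in_inj A1)/add_in; [left|right].
Qed.

Lemma join_prime_m_irreducible U :
  (1 : A) != 0 -> join_prime U -> m_irreducible (supported_in U).
Proof.
move=> A1 primeU J K /monomial_idealP[V upV ->] /monomial_idealP[W upW ->].
rewrite -supported_inI => /(supported_in_inj A1) UVW.
(* If [V] is not inside [U], a witness [a] forces every [b] of [W] into [U]. *)
have [VU|/existsNP[a /not_implyP[Va nUa]]] := pselect (V `<=` U).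
  left; congr supported_in; apply/seteqP; split=> //.
  by rewrite UVW => k [].
right; congr supported_in; apply/seteqP; split=> [|b Wb].
  by rewrite UVW => k [].
have: U (join a b).
  by rewrite UVW; split; [apply: upset_joinl|apply: upset_joinr].
by case/primeU.
Qed.

Lemma m_irreducible_join_primeP U :
  (1 : A) != 0 -> upset U -> m_irreducible (supported_in U) <-> join_prime U.
Proof.
move=> A1 upU; split; first exact: m_irreducible_join_prime.
exact: join_prime_m_irreducible.
Qed.

Lemma supported_in_trivial U :
  (1 : A) = 0 -> supported_in U = setT.
Proof.
move=> A1; apply/seteqP; split=> // f _ k.
by rewrite -mcoeff_neq0 -[f@_k]mul1r A1 mul0r eqxx.
Qed.

End MonomialIdealsAsUpsets.

Theorem theorem1p1 (R : realType) (A : comPzRingType) (d : nat)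
    (hd : (1 <= d)%N) (I : set (real_exp_ring R A d))
    (hI : monomial_ideal I) :
  m_irreducible I <-> generated_by_pure_powers I.
Proof.
have [U upU ->] := (monomial_idealP I).1 hI.
have [A1|A1] := eqVneq (1 : A)%R 0%R.
  split=> _.
    apply/generated_by_pure_powersP; exists (up_closure set0).
      by exists set0 => // s [].
    by rewrite !supported_in_trivial.
  move=> J K /monomial_idealP[V _ ->] _ _; left.
  by rewrite !supported_in_trivial.
rewrite m_irreducible_join_primeP // join_prime_axis_generatedP //.
rewrite generated_by_pure_powersP; split=> [axU|[V axV /(supported_in_inj A1)->//]].
by exists U.
Qed.
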